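(* Let $T(j_m|k)$ and $S(j_w|k)$ be the transition probabilities of two discrete memoryless channels (the main channel and the wiretapper's channel) with common input alphabet $\{1,\dots,K\}$ and output alphabets $\{1,\dots,J_m\}$ and $\{1,\dots,J_w\}$, respectively. Let $n\ge1$, let $M,L\ge 1$ be integers, and define $R_1,R_2$ by $ML=e^{nR_1}$ and $L=e^{nR_2}$. Let $Q_2$ be a probability distribution on $\{1,\dots,K\}$ attaining the maximum over $Q$ in the definition of $$E_w(R_2)=\max_{0\le\rho_2\le1}\max_Q\,[E_2(\rho_2,Q)-\rho_2R_2],$$ and let $$E_m(R_1)=\max_{0\le\rho_1\le1}[E_1(\rho_1,Q_2)-\rho_1R_1],$$ where $$E_1(\rho,Q)=-\log\sum_{j=1}^{J_m}\Big[\sum_{k=1}^{K}Q(k)T(j|k)^{1/(1+\rho)}\Big]^{1+\rho},\qquad E_2(\rho,Q)=-\log\sum_{j=1}^{J_w}\Big[\sum_{k=1}^{K}Q(k)S(j|k)^{1/(1+\rho)}\Big]^{1+\rho}.$$ Then, for the random code ensemble with input distribution $Q_2$ described in the context, for every index $m=(u,v)\in\{1,\dots,M\}\times\{1,\dots,L\}$, $$\overline{P}_{E,m}\le \exp\{-nE_m(R_1)\}+\exp\{-nE_w(R_2)\},$$ and, for every probability distribution $\Pr\{m\}$ on the indices, with $\overline{P}_E=\sum_m\Pr\{m\}\overline{P}_{E,m}$, $$\overline{P}_{E}\le \exp\{-nE_m(R_1)\}+\exp\{-nE_w(R_2)\}.$$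
   Context: Logarithms are natural. ''$Q_2$ attains the maximum'' means that there is $\rho_2\in[0,1]$ with $E_2(\rho_2,Q_2)-\rho_2R_2=E_w(R_2)$; $Q$ ranges over probability distributions on $\{1,\dots,K\}$. Random code ensemble: $ML$ words $\mathbf{x}_m$, indexed by $m=(u,v)$ with $u\in\{1,\dots,M\}$, $v\in\{1,\dots,L\}$, are chosen pairwise independently from the set of length-$n$ input sequences, each according to $Q_n(\mathbf{x})=\prod_{i=1}^nQ_2(x_i)$. (Row $u$ is the code $C_u=\{\mathbf{x}_{(u,v')}:1\le v'\le L\}$ used to transmit message $u$.) Channels: $T_n(\mathbf{y}|\mathbf{x})=\prod_iT(y_i|x_i)$ and $S_n(\mathbf{z}|\mathbf{x})=\prod_iS(z_i|x_i)$ are the block transition probabilities, and $TS_n(\mathbf{y},\mathbf{z}|\mathbf{x})$ is a joint conditional distribution of the two outputs given the input, with marginals $T_n(\mathbf{y}|\mathbf{x})$ and $S_n(\mathbf{z}|\mathbf{x})$. Event $E$: suppose $\mathbf{x}_m$ with $m=(u,v)$ is transmitted and $\mathbf{y},\mathbf{z}$ are received on the main channel and on the wiretapper's channel. $E$ is the event that at least one of the following occurs: (i) there is $m'=(u',v')$ with $u'\ne u$ and $T_n(\mathbf{y}|\mathbf{x}_{m'})\ge T_n(\mathbf{y}|\mathbf{x}_m)$; (ii) there is $m'=(u,v')$ with $v'\ne v$ and $S_n(\mathbf{z}|\mathbf{x}_{m'})\ge S_n(\mathbf{z}|\mathbf{x}_m)$. $\overline{P}_{E,m}$ is the probability of $E$,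 averaged over the ensemble and the channel outputs, when the word with index $m$ is transmitted: $$\overline{P}_{E,m}=\sum_{\mathbf{x}_m}\sum_{\mathbf{y}}\sum_{\mathbf{z}}Q_n(\mathbf{x}_m)\,TS_n(\mathbf{y},\mathbf{z}|\mathbf{x}_m)\,\Pr\{E\mid m,\mathbf{x}_m,\mathbf{y},\mathbf{z}\}.$$ *)

(* Defs.v *)
From HB Require Import structures.
From mathcomp Require Import all_boot all_order all_algebra.
From mathcomp Require Import boolp classical_sets reals sequences exp.

Set Implicit Arguments.
Unset Strict Implicit.
Unset Printing Implicit Defensive.

Import Order.TTheory GRing.Theory Num.Theory.

Local Open Scope classical_set_scope.
Local Open Scope ring_scope.

(* Alphabets {1, ..., K} are rendered as ['I_K]; words of length n over such an
   alphabet are finite functions. *)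
Notation word n K := {ffun 'I_n -> 'I_K}.

Definition is_dist (R : realType) (X : finType) (p : X -> R) : Prop :=
  (forall x, 0 <= p x) /\ \sum_x p x = 1.

(* Transition probabilities are written input first: [W x y] is W(y|x). *)
Definition is_channel (R : realType) (X Y : finType) (W : X -> Y -> R) : Prop :=
  forall x, is_dist (W x).

(* The greatest element of A, with junk value 0 if A has none (compare
   [maximumE]); unlike [sup A], it is required to belong to A. *)
Definition maximum (R : realType) (A : set R) : R := xget 0 (A `&` ubound A).

Lemma maximumE (R : realType) (A : set R) (a : R) :
  A a -> ubound A a -> maximum A = a.
Proof.
move=> Aa uAa; rewrite /maximum; apply: xget_subset1; first by split.
by move=> x y [Ax ux] [Ay uy]; apply/le_anti; rewrite uy// ux.
Qed.

(* Gallager's function; with W := T it is E_1(rho, Q), with W := S it is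
   E_2(rho, Q). *)
Definition gallagerE (R : realType) (K J : nat) (W : 'I_K -> 'I_J -> R)
    (rho : R) (Q : 'I_K -> R) : R :=
  - ln (\sum_(j < J)
          (\sum_(k < K) Q k * (W k j `^ (1 / (1 + rho)))) `^ (1 + rho)).

Definition Em (R : realType) (K J : nat) (T : 'I_K -> 'I_J -> R)
    (Q2 : 'I_K -> R) (R1 : R) : R :=
  maximum [set gallagerE T rho1 Q2 - rho1 * R1 |
           rho1 in [set rho1 : R | 0 <= rho1 <= 1]].

Definition Ew (R : realType) (K J : nat) (S : 'I_K -> 'I_J -> R)
    (R2 : R) : R :=
  maximum [set maximum [set gallagerE S rho2 Q - rho2 * R2 |
                        Q in [set Q : 'I_K -> R | is_dist Q]] |
           rho2 in [set rho2 : R | 0 <= rho2 <= 1]].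

Definition attains_Ew (R : realType) (K J : nat) (S : 'I_K -> 'I_J -> R)
    (R2 : R) (Q2 : 'I_K -> R) : Prop :=
  exists rho2 : R,
    0 <= rho2 <= 1 /\ gallagerE S rho2 Q2 - rho2 * R2 = Ew S R2.

Definition dist_n (R : realType) (n K : nat) (Q : 'I_K -> R) (x : word n K) : R :=
  \prod_(i < n) Q (x i).

Definition channel_n (R : realType) (n K J : nat) (W : 'I_K -> 'I_J -> R)
    (x : word n K) (y : word n J) : R :=
  \prod_(i < n) W (x i) (y i).

(* TS is a joint conditional law of the two outputs with marginals T_n and S_n;
   nothing else (such as memorylessness) is required of it. *)
Definition is_coupling (R : realType) (n K Jm Jw : nat)
    (T : 'I_K -> 'I_Jm -> R) (S : 'I_K -> 'I_Jw -> R)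
    (TS : word n K -> word n Jm * word n Jw -> R) : Prop :=
  [/\ is_channel TS,
      forall x y, \sum_z TS x (y, z) = channel_n T x y &
      forall x z, \sum_y TS x (y, z) = channel_n S x z].

(* A codebook assigns a word to each index m = (u, v); a random code ensemble
   is a probability distribution on codebooks. *)
Notation codebook M L n K := {ffun 'I_M * 'I_L -> word n K}.

Definition pr (R : realType) (X : finType) (P : X -> R) (A : pred X) : R :=
  \sum_(c | A c) P c.

(* Equal to 0 when the conditioning event B has probability 0. *)
Definition cond_pr (R : realType) (X : finType) (P : X -> R) (A B : pred X) : R :=
  pr P [pred c | A c && B c] / pr P B.

(* Only pairwise independence of the codewords is required. *)
Definition is_ensemble (R : realType) (M L n K : nat) (Q : 'I_K -> R)
    (P : codebook M L n K -> R) : Prop :=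
  [/\ is_dist P,
      forall m x, pr P [pred c : codebook M L n K | c m == x] = dist_n Q x &
      forall m m' x x', m != m' ->
        pr P [pred c : codebook M L n K | (c m == x) && (c m' == x')]
        = pr P [pred c : codebook M L n K | c m == x]
          * pr P [pred c : codebook M L n K | c m' == x']].

(* The event E, as a set of codebooks, when the word of index m is transmitted
   and y, z are received. *)
Definition eventE (R : realType) (M L n K Jm Jw : nat)
    (T : 'I_K -> 'I_Jm -> R) (S : 'I_K -> 'I_Jw -> R)
    (m : 'I_M * 'I_L) (y : word n Jm) (z : word n Jw) :
    pred (codebook M L n K) :=
  [pred c : codebook M L n K |
    [exists m' : 'I_M * 'I_L,
       (m'.1 != m.1) && (channel_n T (c m') y >= channel_n T (c m) y)]
    || [exists v' : 'I_L,
       (v' != m.2) && (channel_n S (c (m.1, v')) z >= channel_n S (c m) z)]].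

Definition PEm (R : realType) (M L n K Jm Jw : nat)
    (T : 'I_K -> 'I_Jm -> R) (S : 'I_K -> 'I_Jw -> R)
    (TS : word n K -> word n Jm * word n Jw -> R) (Q : 'I_K -> R)
    (P : codebook M L n K -> R) (m : 'I_M * 'I_L) : R :=
  \sum_(x : word n K) \sum_(y : word n Jm) \sum_(z : word n Jw)
    dist_n Q x * TS x (y, z)
    * cond_pr P (eventE T S m y z) [pred c : codebook M L n K | c m == x].

Definition PE (R : realType) (M L n K Jm Jw : nat)
    (T : 'I_K -> 'I_Jm -> R) (S : 'I_K -> 'I_Jw -> R)
    (TS : word n K -> word n Jm * word n Jw -> R) (Q : 'I_K -> R)
    (P : codebook M L n K -> R) (p : 'I_M * 'I_L -> R) : R :=
  \sum_m p m * PEm T S TS Q P m.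

(* Main.v *)
Require Import Defs.
From HB Require Import structures.
From mathcomp Require Import all_boot all_order all_algebra.
From mathcomp Require Import boolp classical_sets reals sequences exp.

Set Implicit Arguments.
Unset Strict Implicit.
Unset Printing Implicit Defensive.

Import Order.TTheory GRing.Theory Num.Theory.
Local Open Scope ring_scope.

(* Given that [x] is sent and [y] received, the union bound over [N] competitors
   and pairwise independence bound the conditional probability of confusion by
   [N * sum_x' Q(x')] over the [x'] with [W(y|x) <= W(y|x')], and
   [1 <= (W(y|x') / W(y|x)) ^ (1 / (1 + rho))] on this range.  Since a
   probability [p] is at most [b ^ rho] whenever [p <= b], averaging over [x] and
   [y] gives Gallager's bound, which factors over the [n] letters.  The two
   parts of the event are handled separately: the first depends on the outputs
   only through [y], the second only through [z], so each sees only one of the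
   marginals of the joint channel.  The competitors number fewer than [M * L] in
   the first part and fewer than [L] in the second. *)

(** * Gallager's bound and its exponent *)

Section Gallager.
Variable R : realType.
Implicit Types rho r N : R.

(** If [b <= 1] then [b <= b ^ rho] because [rho <= 1]; otherwise [b ^ rho] is at least 1, hence at
    least [a]. *)
Lemma le_powR_of_le_one (a b rho : R) :
  0 <= rho <= 1 -> 0 <= b -> a <= 1 -> a <= b -> a <= b `^ rho.
Proof.
move=> /andP[rho0 rho1] b0 a1 ab; have [b1|b1] := leP b 1; last first.
  by apply: le_trans a1 _; rewrite -(powRr0 b) ler_powR// ltW.
apply: le_trans ab _; move: b0; rewrite le_eqVlt => /predU1P[<-|b0].
  exact: powR_ge0.
by apply: ger1_powR => //; rewrite b0 b1.
Qed.

Lemma powR_prod (I : finType) (f : I -> R) (r : R) :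
  (forall i, 0 <= f i) -> (\prod_i f i) `^ r = \prod_i f i `^ r.
Proof.
move=> f0; pose K (x y : R) := 0 <= x /\ x `^ r = y.
suff [] : K (\prod_i f i) (\prod_i f i `^ r) by [].
apply: (big_ind2 K) => //; first by split; rewrite ?powR1.
move=> x _ y _ [x0 <-] [y0 <-]; split; first exact: mulr_ge0.
exact: powRM.
Qed.

(* The choice of exponent makes [w x = t * t `^ rho] for [t = w x `^ s], so that
   the factor [t `^ (- rho)] produced by the union bound turns [w x] into [t]. *)
Lemma gallager_sum (X : finType) (q w a : X -> R) (N rho : R) :
    (forall x, 0 <= q x) -> (forall x, 0 <= w x) -> 0 <= N -> 0 <= rho <= 1 ->
    (forall x, a x <= 1) ->
    (forall x, a x <= N * \sum_(x' | w x <= w x') q x') ->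
  \sum_x q x * w x * a x
  <= N `^ rho * (\sum_x q x * w x `^ (1 / (1 + rho))) `^ (1 + rho).
Proof.
move=> q0 w0 N0 rho01 a1 aN; have /andP[rho0 _] := rho01.
have rho1_gt0 : 0 < 1 + rho by rewrite ltr_pwDl.
set s := 1 / (1 + rho); set G := \sum_x q x * w x `^ s.
have G0 : 0 <= G by apply: sumr_ge0 => x _; rewrite mulr_ge0 ?powR_ge0.
(* One factor [G] is set apart, to be compared with the left side term by term in [x];
   [(N * G) ^ rho] is common to all terms. *)
have -> : N `^ rho * G `^ (1 + rho) = G * (N * G) `^ rho.
  by rewrite powRM// powRD ?(gt_eqF rho1_gt0)// powRr1// mulrCA.
rewrite [in leRHS]/G mulr_suml; apply: ler_sum => x _.
rewrite -!mulrA ler_wpM2l//.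
have := w0 x; rewrite le_eqVlt => /predU1P[<-|wx0].
  by rewrite mul0r mulr_ge0 ?powR_ge0.
pose t := w x `^ s; have t0 : 0 < t by exact: powR_gt0.
have wE : w x = t * t `^ rho.
  transitivity (t `^ (1 + rho)).
    by rewrite -powRrM /s mul1r mulVf ?gt_eqF// powRr1.
  by rewrite powRD ?(gt_eqF rho1_gt0)// powRr1// ltW.
have -> : w x `^ s * (N * G) `^ rho = w x * (N * G / t) `^ rho.
  rewrite -/t wE -mulrA -powRM ?divr_ge0 ?mulr_ge0 ?(ltW t0)//.
  by rewrite [t * (_ / t)]mulrC divfK ?gt_eqF.
rewrite ler_wpM2l//; apply: le_powR_of_le_one => //.
  by rewrite divr_ge0 ?mulr_ge0// ltW.
apply: le_trans (aN x) _; rewrite -mulrA ler_wpM2l// ler_pdivlMr//.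
(* Terms of [G] outside the range are dropped; on it, [t <= w x' ^ s] by monotonicity. *)
rewrite mulr_suml /G [leRHS](bigID (fun x' => w x <= w x'))/=.
rewrite -[leLHS]addr0 lerD//; last first.
  by apply: sumr_ge0 => y _; rewrite mulr_ge0 ?powR_ge0.
apply: ler_sum => y wxy; rewrite ler_wpM2l//.
by apply: ge0_ler_powR; rewrite ?nnegrE// /s divr_ge0 ?ltW.
Qed.

(** Sums over words of products over letters are products of sums over letters; this applies to [x]
    inside the power and to [y] outside it. *)
Lemma gallager_channel_n (n K J : nat) (W : 'I_K -> 'I_J -> R) (Q : 'I_K -> R)
    (rho : R) :
    0 <= rho -> is_channel W -> is_dist Q ->
  \sum_(y : word n J)
    (\sum_(x : word n K) dist_n Q x * channel_n W x y `^ (1 / (1 + rho)))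
      `^ (1 + rho)
  <= expR (- (n%:R * gallagerE W rho Q)).
Proof.
move=> rho0 hW [Q0 _]; set s := 1 / (1 + rho).
have W0 k j : 0 <= W k j by case: (hW k).
pose g j := \sum_(k < K) Q k * W k j `^ s.
have g0 j : 0 <= g j by apply: sumr_ge0 => k _; rewrite mulr_ge0 ?powR_ge0.
rewrite (eq_bigr (fun y : word n J => \prod_i g (y i) `^ (1 + rho))).
  rewrite -(bigA_distr_bigA (fun (_ : 'I_n) j => g j `^ (1 + rho)))/=.
  rewrite prodr_const card_ord /gallagerE mulrN opprK expRM_natl -/s.
  set A := \sum_j _.
  have A0 : 0 <= A by apply: sumr_ge0 => j _; exact: powR_ge0.
  rewrite lerXn2r ?nnegrE ?expR_ge0//.
  (* [lnK] asks for a positive argument; a zero [A] lies below any exponential. *)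
  move: A0; rewrite le_eqVlt => /predU1P[<-|A0]; first exact: expR_ge0.
  by rewrite lnK.
move=> y _; rewrite -powR_prod// bigA_distr_bigA; congr (_ `^ _).
apply: eq_bigr => x _.
by rewrite /dist_n /channel_n powR_prod// -big_split/=.
Qed.

(** At [rho = 0] the inner sums are the output probabilities, which sum to 1. *)
Lemma gallagerE0 (K J : nat) (W : 'I_K -> 'I_J -> R) (Q : 'I_K -> R) :
  is_channel W -> is_dist Q -> gallagerE W 0 Q = 0.
Proof.
move=> hW [Q0 Q1]; rewrite /gallagerE addr0 divr1.
have W0 k j : 0 <= W k j by case: (hW k).
rewrite (eq_bigr (fun j => \sum_(k < K) Q k * W k j)) => [|j _].
  rewrite exchange_big/= (eq_bigr Q) ?Q1 ?ln1 ?oppr0// => k _.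
  by rewrite -mulr_sumr; case: (hW k) => _ ->; rewrite mulr1.
rewrite powRr1; last by apply: sumr_ge0 => k _; rewrite mulr_ge0 ?powR_ge0.
by apply: eq_bigr => k _; rewrite powRr1.
Qed.

(* Gallager's function vanishes at [rho = 0], so the junk value of [maximum] is
   also a value of the maximised function: no appeal to compactness of [0, 1]
   is needed. *)
Lemma Em_attained (K J : nat) (W : 'I_K -> 'I_J -> R) (Q : 'I_K -> R) (r : R) :
    is_channel W -> is_dist Q ->
  exists2 rho, 0 <= rho <= 1 & Em W Q r = gallagerE W rho Q - rho * r.
Proof.
move=> hW hQ; rewrite /Em /maximum.
case: xgetP => [_ _ [[rho rho01 <-] _]|_]; first by exists rho.
by exists 0; rewrite ?lexx ?ler01// gallagerE0// mul0r subr0.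
Qed.

End Gallager.

(** * Union bounds and conditioning *)

Section Probability.
Variables (R : realType) (X : finType) (P : X -> R).
Hypothesis P0 : forall c, 0 <= P c.
Implicit Types A B C : pred X.

Lemma pr_ge0 A : 0 <= pr P A.
Proof. exact: sumr_ge0. Qed.

Lemma le_pr A B : (forall c, A c -> B c) -> pr P A <= pr P B.
Proof.
move=> AB; rewrite /pr big_mkcond [leRHS]big_mkcond; apply: ler_sum => c _.
by have := AB c; case: (A c); case: (B c) => // /(_ isT).
Qed.

Lemma prU A B : pr P [pred c | A c || B c] <= pr P A + pr P B.
Proof.
rewrite /pr [leLHS]big_mkcond [X in X + _]big_mkcond [X in _ + X]big_mkcond/=.
rewrite -big_split/=; apply: ler_sum => c _.
by case: (A c); case: (B c); rewrite /= ?addr0 ?add0r// lerDl.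
Qed.

Lemma pr_bigU (I : finType) (A : I -> pred X) :
  pr P [pred c | [exists i, A i c]] <= \sum_i pr P (A i).
Proof.
rewrite /pr (eq_bigr (fun i => \sum_c if A i c then P c else 0)); last first.
  by move=> i _; rewrite big_mkcond.
rewrite exchange_big [leLHS]big_mkcond/=; apply: ler_sum => c _.
have ge0 (i : I) : 0 <= (if A i c then P c else 0) by case: ifP.
case: ifPn => [/existsP[i Ai]|_]; last exact: sumr_ge0.
by rewrite (bigD1 i)//= Ai lerDl sumr_ge0.
Qed.

Lemma cond_pr_le1 A B : cond_pr P A B <= 1.
Proof.
rewrite /cond_pr; have := pr_ge0 B; rewrite le_eqVlt => /predU1P[<-|B0].
  by rewrite invr0 mulr0.
by rewrite ler_pdivrMr// mul1r; apply: le_pr => c /andP[].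
Qed.

Lemma cond_prU A B C :
  cond_pr P [pred c | A c || B c] C <= cond_pr P A C + cond_pr P B C.
Proof.
rewrite /cond_pr -mulrDl ler_wpM2r ?invr_ge0 ?pr_ge0//.
apply: le_trans (prU _ _); apply: le_pr => c /=.
by rewrite andb_orl.
Qed.

End Probability.

(** The competitors form a family [f] restricted by [D], so as to cover both parts of the event:
    words of other rows, and other words of the same row. *)
Lemma cond_pr_confusable (R : realType) (I B X : finType)
    (P : {ffun I -> X} -> R) (q w : X -> R) (m : I) (D : pred B) (f : B -> I)
    (x : X) :
    (forall c, 0 <= P c) ->
    (forall i x', pr P [pred c : {ffun I -> X} | c i == x'] = q x') ->
    (forall i x', i != m ->
      pr P [pred c : {ffun I -> X} | (c m == x) && (c i == x')] = q x * q x') ->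
    (forall b, D b -> f b != m) ->
  cond_pr P
    [pred c : {ffun I -> X} | [exists b, D b && (w (c m) <= w (c (f b)))]]
    [pred c : {ffun I -> X} | c m == x]
  <= #|B|%:R * \sum_(x' | w x <= w x') q x'.
Proof.
move=> P0 Pq Pqq Dm.
have q0 x' : 0 <= q x' by rewrite -(Pq m) pr_ge0.
have s0 : 0 <= \sum_(x' | w x <= w x') q x' by exact: sumr_ge0.
rewrite /cond_pr Pq; have := q0 x.
(* Conditioning on an event of probability 0 gives 0 by convention. *)
rewrite le_eqVlt => /predU1P[<-|qx0].
  by rewrite invr0 mulr0 mulr_ge0.
rewrite ler_pdivrMr//.
pose A b : pred {ffun I -> X} :=
  [pred c : {ffun I -> X} | D b && (w x <= w (c (f b))) && (c m == x)].
apply: (@le_trans _ _ (\sum_b pr P (A b))).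
  apply: le_trans (pr_bigU P0 A); apply: le_pr => // c /=.
  case/andP => /existsP[b Db] /eqP cm; apply/existsP; exists b.
  by rewrite /A /= -cm Db eqxx.
have -> : #|B|%:R * (\sum_(x' | w x <= w x') q x') * q x =
    \sum_(b : B) (\sum_(x' | w x <= w x') q x') * q x.
  by rewrite sumr_const -mulrA mulr_natl.
apply: ler_sum => b _; rewrite /A /=; have := Dm b.
(* An index [b] outside [D] gives an empty event, so [#|B|] may count it. *)
case: (D b) => /= [/(_ isT) fbm|_]; last first.
  by rewrite /pr big_pred0_eq mulr_ge0// ltW.
(* Splitting by the competitor's word [x'] yields joint events of two words, where pairwise
   independence applies. *)
rewrite /pr (partition_big (fun c : {ffun I -> X} => c (f b))
  (fun x' => w x <= w x'))/=; last by move=> c /andP[].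
rewrite mulr_suml; apply: ler_sum => x' wx'.
rewrite mulrC -(Pqq _ _ fbm) /pr le_eqVlt; apply/predU1P; left.
apply: eq_bigl => c /=; rewrite -andbA.
by case: (c m == x); rewrite ?andbF//=; case: eqP => [->|]; rewrite ?wx' ?andbF.
Qed.

Lemma sum_confusable_le (R : realType) (K J n M L : nat)
    (W : 'I_K -> 'I_J -> R) (Q : 'I_K -> R) (P : codebook M L n K -> R)
    (B : finType) (D : pred B) (f : B -> 'I_M * 'I_L) (m : 'I_M * 'I_L)
    (rho r : R) :
    is_channel W -> is_dist Q -> is_ensemble Q P ->
    (forall b, D b -> f b != m) ->
    #|B|%:R = expR (n%:R * r) -> 0 <= rho <= 1 ->
  \sum_(x : word n K) \sum_(y : word n J) dist_n Q x * channel_n W x y *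
    cond_pr P
      [pred c : codebook M L n K |
        [exists b, D b && (channel_n W (c m) y <= channel_n W (c (f b)) y)]]
      [pred c : codebook M L n K | c m == x]
  <= expR (- (n%:R * (gallagerE W rho Q - rho * r))).
Proof.
move=> hW hQ [[P0 _] Pq Pqq] Dm Br rho01; have /andP[rho0 _] := rho01.
rewrite exchange_big/=.
apply: (@le_trans _ _ (\sum_(y : word n J) #|B|%:R `^ rho *
    (\sum_(x : word n K) dist_n Q x * channel_n W x y `^ (1 / (1 + rho)))
      `^ (1 + rho))).
  apply: ler_sum => y _; apply: gallager_sum => //.
  - by move=> x; apply: prodr_ge0 => i _; case: hQ.
  - by move=> x; apply: prodr_ge0 => i _; case: (hW (x i)).
  - by move=> x; exact: cond_pr_le1.
  move=> x; apply: (@cond_pr_confusable _ _ _ _ _ (dist_n Q)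
    (fun x : word n K => channel_n W x y)) => // i x' im.
  by rewrite Pqq ?Pq// eq_sym.
(* The factor [#|B| ^ rho] supplies the term [rho * r] of the exponent. *)
rewrite -mulr_sumr Br -expRM.
apply: le_trans (ler_wpM2l (expR_ge0 _) (gallager_channel_n _ rho0 hW hQ)) _.
by rewrite -expRD mulrBr opprB mulrA mulrAC.
Qed.

Theorem theorem6 (R : realType) (K Jm Jw n M L : nat)
    (T : 'I_K -> 'I_Jm -> R) (S : 'I_K -> 'I_Jw -> R)
    (R1 R2 : R) (Q2 : 'I_K -> R)
    (TS : word n K -> word n Jm * word n Jw -> R)
    (P : codebook M L n K -> R)
    (hT : is_channel T) (hS : is_channel S)
    (hn : (1 <= n)%N) (hM : (1 <= M)%N) (hL : (1 <= L)%N)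
    (hR1 : (M * L)%:R = expR (n%:R * R1))
    (hR2 : L%:R = expR (n%:R * R2))
    (hQ2 : is_dist Q2) (hmax : attains_Ew S R2 Q2)
    (hTS : is_coupling T S TS)
    (hP : is_ensemble Q2 P) :
  (forall m : 'I_M * 'I_L,
     PEm T S TS Q2 P m
     <= expR (- (n%:R * Em T Q2 R1)) + expR (- (n%:R * Ew S R2)))
  /\
  (forall p : 'I_M * 'I_L -> R, is_dist p ->
     PE T S TS Q2 P p
     <= expR (- (n%:R * Em T Q2 R1)) + expR (- (n%:R * Ew S R2))).
Proof.
have [hP0 hPq hPqq] := hP.
have bound m : PEm T S TS Q2 P m
    <= expR (- (n%:R * Em T Q2 R1)) + expR (- (n%:R * Ew S R2)).
  (* Each maximum becomes a value at one [rho], both for the input law [Q2]. *)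
  have [rho1 rho1_01 ->] := Em_attained R1 hT hQ2.
  have [rho2 [rho2_01 <-]] := hmax.
  have [hch hTn hSn] := hTS.
  have q0 (x : word n K) : 0 <= dist_n Q2 x.
    by apply: prodr_ge0 => i _; case: hQ2.
  have := @sum_confusable_le _ _ _ _ _ _ T Q2 P ('I_M * 'I_L)%type
    (fun m' => m'.1 != m.1) id m rho1 R1 hT hQ2 hP.
  have := @sum_confusable_le _ _ _ _ _ _ S Q2 P 'I_L
    (fun v' => v' != m.2) (fun v' => (m.1, v')) m rho2 R2 hS hQ2 hP.
  set a2 := fun (x : word n K) (z : word n Jw) => cond_pr P
    [pred c : codebook M L n K | [exists v' : 'I_L, (v' != m.2) &&
       (channel_n S (c m) z <= channel_n S (c (m.1, v')) z)]]
    [pred c : codebook M L n K | c m == x].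
  set a1 := fun (x : word n K) (y : word n Jm) => cond_pr P
    [pred c : codebook M L n K | [exists m' : 'I_M * 'I_L, (m'.1 != m.1) &&
       (channel_n T (c m) y <= channel_n T (c m') y)]]
    [pred c : codebook M L n K | c m == x].
  move=> le2 le1.
  apply: (@le_trans _ _
    (\sum_x \sum_y dist_n Q2 x * channel_n T x y * a1 x y +
     \sum_x \sum_z dist_n Q2 x * channel_n S x z * a2 x z)); last first.
    apply: lerD.
      apply: le1 => //; last by rewrite card_prod !card_ord.
      by move=> [u v]; apply: contra => /eqP <-.
    apply: le2 => //; last by rewrite card_ord.
    by move=> v; apply: contra => /eqP <-.
  rewrite -big_split; apply: ler_sum => x _ /=.
  (* Since [a1] does not depend on [z], the marginal can be expanded into the joint law; likewise
     for [a2] and [y]. *)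
  have -> : \sum_y dist_n Q2 x * channel_n T x y * a1 x y =
      \sum_y \sum_z dist_n Q2 x * TS x (y, z) * a1 x y.
    by apply: eq_bigr => y _; rewrite -mulr_suml -mulr_sumr hTn.
  have -> : \sum_z dist_n Q2 x * channel_n S x z * a2 x z =
      \sum_y \sum_z dist_n Q2 x * TS x (y, z) * a2 x z.
    rewrite exchange_big/=.
    by apply: eq_bigr => z _; rewrite -mulr_suml -mulr_sumr hSn.
  rewrite -big_split; apply: ler_sum => y _ /=.
  rewrite -big_split; apply: ler_sum => z _ /=.
  rewrite -mulrDr ler_wpM2l//; first by rewrite mulr_ge0//; case: (hch x).
  by apply: cond_prU; case: hP0.
split=> [//|p [p0 p1]]; rewrite /PE; set b := leRHS.
rewrite -[b]mul1r -p1 mulr_suml; apply: ler_sum => m _.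
by rewrite ler_wpM2l// bound.
Qed.
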